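(* Let $n\ge 3$ and $k\ge 1$ be integers, and suppose that $n$ is even or $k\le \frac{3(n-1)}{2}$. Then there exists a generating set $A$ of $D_n^k$ with $|A|=\operatorname{rank}(D_n^k)$ and $$\operatorname{diam}(D_n^k,A)\le k\,(|D_n|-\operatorname{rank}(D_n)).$$
   Context: $D_n$ is the dihedral group, i.e. the group of symmetries of a regular polygon with $n$ sides (of order $2n$); $D_n^k$ is its $k$-th direct power. For a finite group $G$ with generating set $A$ and $g\in G$, $l_A(g)$ is the length of a shortest word in the elements of $A$ (no inverses allowed) representing $g$; the identity is represented by the empty word, of length $0$. The diameter is $\operatorname{diam}(G,A)=\max\{l_A(g): g\in G\}$. $\operatorname{rank}(G)$ is the minimum cardinality of a generating set of $G$. *)

(* Defs.v *)
From HB Require Import structures.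
From mathcomp Require Import all_boot all_fingroup all_solvable.

Set Implicit Arguments.
Unset Strict Implicit.
Unset Printing Implicit Defensive.

Import GroupScope.

(* 'D_m is indexed by the order m of the group, so the symmetry group of the
   regular n-gon is 'D_(2n). *)
Definition dihedral (n : nat) : finGroupType := ('D_(n.*2))%type.

Definition dihedral_power (n k : nat) : finGroupType :=
  {dffun forall _ : 'I_k, dihedral n}.

(* No inverses: w is a word over A itself. *)
Definition has_word (gT : finGroupType) (A : {set gT}) (g : gT) (l : nat) :
    bool :=
  [exists w : l.-tuple gT, all (mem A) w && (\prod_(x <- w) x == g)].

Lemma has_word_gen (gT : finGroupType) (A : {set gT}) (g : gT) :
  exists l, (g \in <<A>>) ==> has_word A g l.
Proof.
case: (boolP (g \in <<A>>)) => [/gen_prodgP[l [c Ac ->]] | _]; last by exists 0.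
exists l; apply/existsP; exists [tuple c i | i < l]; apply/andP; split.
  by apply/allP=> _ /mapP[i _ ->]; apply: Ac.
by rewrite big_tuple; apply/eqP/eq_bigr=> i _; rewrite tnth_mktuple.
Qed.

(* Total in g: the value is 0 when g is not generated by A. *)
Definition word_length (gT : finGroupType) (A : {set gT}) (g : gT) : nat :=
  ex_minn (has_word_gen A g).

Lemma word_lengthP (gT : finGroupType) (A : {set gT}) (g : gT) :
  g \in <<A>> ->
  has_word A g (word_length A g) /\
  (forall l, has_word A g l -> word_length A g <= l).
Proof.
move=> gA; rewrite /word_length; case: ex_minnP => l; rewrite gA /= => wl minl.
by split=> // l' wl'; apply: minl; rewrite wl'.
Qed.

Definition diam (gT : finGroupType) (G A : {set gT}) : nat :=
  \max_(g in G) word_length A g.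

(* Main.v *)
(* Write r and s for a rotation and a reflection generating D_n.  The rank is
   bounded below by the elementary abelian quotient by the power of <r^2>.  If n
   is even or k = 1, the copies of r and s in the k factors form a minimal
   generating set of diameter at most kn <= k(2n - 2).

   If n is odd and k >= 2, the k elements a_i = s_i r_(i+1), with i taken modulo
   k, form one.  A product of the blocks a_i^(m_i), in any order, has in
   component i either s^(m_i) r^(m_(i-1)) or r^(m_(i-1)) s^(m_i), according to
   the relative order of the blocks i and i-1; these k choices are free once the
   cycle is cut at one component j.  Let e_i be the exponent of s in component i
   of the target, so that m_i must have the parity of e_i and a prescribed value
   modulo n.  When e_i = 1, choosing the order amounts to choosing the sign of
   m_(i-1) modulo n, so m_(i-1) <= n is possible; when e_i = 0 the order is
   irrelevant and m_(i-1) <= 2n - 2 + e_(i-1).  In both cases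
   m_(i-1) + e_i <= 2n - 2 + e_(i-1), and summing over i gives k(2n - 2), provided
   that e_j = 0.  If all e_i are 1, then all m_i but one are at most n. *)
Require Import Defs.
From mathcomp Require Import all_boot all_fingroup all_solvable all_algebra.
From mathcomp Require Import zify.

Set Implicit Arguments.
Unset Strict Implicit.
Unset Printing Implicit Defensive.

Import GroupScope.

(** * Words, generation and diameter *)

Lemma has_word1 (gT : finGroupType) (A : {set gT}) : has_word A 1 0.
Proof. by apply/existsP; exists [tuple]; rewrite /= big_nil eqxx. Qed.

Lemma has_wordM (gT : finGroupType) (A : {set gT}) (x y : gT) (l m : nat) :
  has_word A x l -> has_word A y m -> has_word A (x * y) (l + m).
Proof.
move=> /existsP[u /andP[Au /eqP<-]] /existsP[v /andP[Av /eqP<-]].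
by apply/existsP; exists (cat_tuple u v); rewrite all_cat Au Av big_cat eqxx.
Qed.

Lemma has_wordX (gT : finGroupType) (A : {set gT}) (x : gT) (m : nat) :
  x \in A -> has_word A (x ^+ m) m.
Proof.
move=> Ax; elim: m => [|m IHm]; first exact: has_word1.
rewrite expgS -[m.+1]add1n; apply: has_wordM => //.
by apply/existsP; exists [tuple x]; rewrite /= Ax big_seq1 eqxx.
Qed.

Lemma has_word_mem_gen (gT : finGroupType) (A : {set gT}) (g : gT) (l : nat) :
  has_word A g l -> g \in <<A>>.
Proof.
case/existsP=> w /andP[/allP Aw /eqP<-]; rewrite big_seq.
by apply: group_prod => x /Aw; apply: mem_gen.
Qed.

Lemma word_length_le (gT : finGroupType) (A : {set gT}) (g : gT) (l : nat) :
  has_word A g l -> word_length A g <= l.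
Proof.
by move=> wl; rewrite /word_length; case: ex_minnP => m _; apply; rewrite wl implybT.
Qed.

Lemma gen_diam_bound (gT : finGroupType) (A : {set gT}) (b : nat) :
    (forall g, exists2 l, l <= b & has_word A g l) ->
  <<A>> = [set: gT] /\ diam [set: gT] A <= b.
Proof.
move=> wA; split.
  by apply/setP=> g; rewrite inE; have [l _ /has_word_mem_gen] := wA g.
apply/bigmax_leqP=> g _; have [l leb wl] := wA g.
exact: leq_trans (word_length_le wl) leb.
Qed.

(** * Lower bound for the rank from a subgroup containing all squares *)

Lemma gen_rank_ge_logn2_indexg (gT : finGroupType) (K : {group gT}) :
  (forall y : gT, y ^+ 2 \in K) -> logn 2 #|[set: gT] : K| <= 'm([set: gT]).
Proof.
move=> sqK.
(* Writing a conjugate as a product of squares and h^-1 makes [K] normal. The quotient has exponent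
   dividing 2, so its rank is the logarithm of its order. *)
have conjK (h y : gT) : h \in K -> h ^ y \in K.
  move=> Kh; have -> : h ^ y = (y^-1) ^+ 2 * (y * h) ^+ 2 * h^-1.
    by rewrite conjgE (expgS _ 1) expg1 (expgS _ 1) expg1 !mulgA mulgK mulgKV.
  by rewrite groupMr ?groupV // groupM.
have nK : [set: gT] \subset 'N(K).
  apply/subsetP=> y _; rewrite inE; apply/subsetP=> _ /imsetP[h Kh ->].
  exact: conjK.
rewrite -card_quotient //; apply: leq_trans (quotient_grank nK).
have ab2 : 2.-abelem ([set: gT] / K).
  apply/exponent2_abelem/exponentP=> _ /morphimP[y Ny _ ->].
  by rewrite -morphX //; apply: coset_id.
by rewrite grank_abelian ?(abelem_abelian ab2) // (rank_abelem ab2).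
Qed.

Lemma gen_rank_power_ge (gT : finGroupType) (H : {group gT}) (k c : nat) :
    (forall y : gT, y ^+ 2 \in H) -> 2 ^ c %| #|[set: gT] : H| ->
  k * c <= 'm([set: {dffun forall _ : 'I_k, gT}]).
Proof.
move=> sqH dvH; pose K := [group of setXn (fun _ : 'I_k => gval H)].
have sqK (g : {dffun forall _ : 'I_k, gT}) : g ^+ 2 \in K.
  by apply/setXnP=> i; rewrite expgS expg1 ffunE; apply: sqH.
apply: leq_trans (gen_rank_ge_logn2_indexg sqK).
rewrite -pfactor_dvdn // -divgS ?subsetT //= cardsXn prod_nat_const card_ord.
have -> : #|[set: {dffun forall _ : 'I_k, gT}]| = (#|[set: gT]| ^ k)%N.
  by rewrite !cardsT card_ffun card_ord.
rewrite -(Lagrange (subsetT H)) expnMn mulKn ?expn_gt0 ?cardG_gt0 //.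
by rewrite mulnC expnM dvdn_exp2r.
Qed.

(** * Rotation, reflection and normal form in a dihedral group *)

Definition dihedral_frame (gT : finGroupType) (n : nat) (r s : gT) : Prop :=
  [/\ #[r] = n, s ^+ 2 = 1, r ^ s = r^-1
    & forall y, exists x (e : bool), x < n /\ y = r ^+ x * s ^+ e].

(** The presentation gives only r^n = 1 and s^2 = 1; the order of [r] is exactly n because <r><s>
    has 2n elements. *)
Lemma dihedral_frame_exists (n : nat) :
  1 < n -> exists r s : dihedral n, dihedral_frame n r s.
Proof.
move=> n_gt1.
have /(isoGrpP _ (Grp_dihedral n_gt1))[_ /existsP[[r s] /= /eqP[defG rn s2 rs]]] :=
  isog_refl [set: dihedral n].
have{} defG : <[r]> * <[s]> = [set: dihedral n].
  by rewrite -norm_joinEr // norms_cycle rs groupV cycle_id.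
have r_dvd : #[r] %| n by rewrite order_dvdn rn.
have s_dvd : #[s] %| 2 by rewrite order_dvdn s2.
have or : #[r] = n.
  apply/eqP; rewrite eqn_leq dvdn_leq ?(ltnW n_gt1) //=.
  have: #|<[r]> * <[s]>| <= #[r] * #[s].
    by rewrite mul_cardG leq_pmulr ?cardG_gt0.
  rewrite defG card_dihedral // -muln2 => le1.
  have := leq_trans le1 (leq_mul (leqnn _) (dvdn_leq (isT : 0 < 2) s_dvd)).
  by rewrite leq_pmul2r.
exists r, s; split=> // y.
have : y \in <[r]> * <[s]> by rewrite defG inE.
case/mulsgP=> _ _ /cyclePmin[x ltx ->] /cyclePmin[e lte ->] ->.
exists x, (e == 1%N); split; first by rewrite -or.
by congr (_ * _); move: (leq_trans lte (dvdn_leq (isT : 0 < 2) s_dvd)); case: e {lte} => [|[]].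
Qed.

(** * Words in direct powers, one component at a time *)

Lemma dffunX (I : finType) (gT : I -> finGroupType)
    (g : {dffun forall i, gT i}) (m : nat) (i : I) : (g ^+ m) i = g i ^+ m.
Proof. by elim: m => [|m IHm]; rewrite ?expg0 ?ffunE // !expgS ffunE IHm. Qed.

Lemma has_word_power (gT : finGroupType) (k b : nat)
    (A : {set {dffun forall _ : 'I_k, gT}}) :
    (forall (i : 'I_k) (y : gT), exists2 l, l <= b &
       has_word A [ffun j => if j == i then y else 1] l) ->
  forall g, exists2 l, l <= k * b & has_word A g l.
Proof.
move=> wA g.
suff /(_ (enum 'I_k) (enum_uniq _))[l lel wl] : forall t : seq 'I_k, uniq t ->
    exists2 l, l <= size t * b &
      has_word A [ffun i => if i \in t then g i else 1] l.
  exists l; first by rewrite size_enum_ord in lel.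
  have -> // : g = [ffun i => if i \in enum 'I_k then g i else 1].
  by apply/ffunP=> i; rewrite ffunE mem_enum.
elim=> [_|i t IHt /= /andP[it /IHt[l lel wl]]].
  exists 0 => //; have -> : [ffun i => if i \in [::] then g i else 1] = 1.
    by apply/ffunP=> i; rewrite !ffunE.
  exact: has_word1.
have [l1 lel1 wl1] := wA i (g i).
exists (l1 + l); first by rewrite mulSn leq_add.
have -> : [ffun i' => if i' \in i :: t then g i' else 1] =
    [ffun j => if j == i then g i else 1]
      * [ffun i' => if i' \in t then g i' else 1]; last exact: has_wordM.
apply/ffunP=> i'; rewrite !ffunE inE.
by case: eqP => [->|_]; rewrite ?(negPf it) ?mulg1 ?mul1g.
Qed.

(** * Rewriting dihedral elements with exponents of prescribed parity *)

Section DihedralFrame.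

Variables (gT : finGroupType) (n : nat) (r s : gT).
Hypothesis rs_frame : dihedral_frame n r s.

(** Conjugation by [s] inverts r^x; the inverse is written r^(n - x) to keep exponents natural. *)
Lemma frame_reflection (x : nat) : x <= n -> r ^+ x * s = s * r ^+ (n - x).
Proof.
case: rs_frame => or _ rs _ lexn.
have -> : r ^+ (n - x) = r^-1 ^+ x.
  by apply: (mulIg (r ^+ x)); rewrite -expgD subnK // -or expg_order expgVn mulVg.
by rewrite -rs -conjXg conjgC.
Qed.

Lemma frame_sX (m : nat) : s ^+ m = s ^+ odd m.
Proof.
case: rs_frame => _ s2 _ _.
by rewrite -[in LHS](odd_double_half m) expgD -mul2n expgM s2 expg1n mulg1.
Qed.

Lemma frame_square (y : gT) : y ^+ 2 \in <[r ^+ 2]>.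
Proof.
case: rs_frame => or s2 rs /(_ y)[x [[] [ltx ->]]]; last first.
  by rewrite expg0 mulg1 -expgM mulnC expgM mem_cycle.
suff -> : (r ^+ x * s ^+ true) ^+ 2 = 1 by apply: group1.
rewrite expg1 (expgS _ 1) expg1 {1}frame_reflection ?(ltnW ltx) //.
rewrite -!mulgA (mulgA (r ^+ _) (r ^+ _)) -expgD subnK ?(ltnW ltx) //.
by rewrite -{1}or expg_order mul1g -[s * s]/(s ^+ 2).
Qed.

Hypothesis n_odd : odd n.

(** For odd n, x and n + x have opposite parities. If n + x is even, it is at most 2n - 2, one less
    than in the odd case. *)
Lemma frame_parity (x : nat) (p : bool) : x < n ->
  exists m, [/\ m <= 2 * n - 2 + p, odd m = p & r ^+ m = r ^+ x].
Proof.
case: rs_frame => or _ _ _ ltx.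
have [<-|xp] := eqVneq (odd x) p; first by exists x; split=> //; lia.
exists (n + x); split; last by rewrite expgD -{1}or expg_order mul1g.
  by move: n_odd xp; case: p => /=; lia.
by rewrite oddD n_odd; move: xp; case: (odd x) p => [] [].
Qed.

Lemma frame_parity_side (b : bool) (x : nat) (e p : bool) : x < n ->
  exists m, [/\ m <= 2 * n - 2 + p, odd m = p &
    (if b then r ^+ m * s ^+ e else s ^+ e * r ^+ m) = r ^+ x * s ^+ e].
Proof.
move=> ltx; case: (boolP (e && ~~ b)) => [/andP[-> /negPf->]|].
  (* Moving r^x across [s] replaces x by n - x, which is below n only if x > 0. *)
  have [->|x0] := posnP x.
    have [m [lem om rm]] := frame_parity p (leq_trans (ltn0Sn x) ltx).
    by exists m; rewrite rm !expg0 mulg1 mul1g.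
  have [|m [lem om rm]] := @frame_parity (n - x) p; first by lia.
  by exists m; rewrite rm !expg1 frame_reflection // ltnW.
move=> eb; have [m [lem om rm]] := frame_parity p ltx.
by exists m; rewrite rm; move: eb; case: e b => [] [] //=; rewrite mulg1 mul1g.
Qed.

(* Both signs of the rotation are available in front of a reflection, and
   [x], [n - x] have opposite parities. *)
Lemma frame_parity_short (x : nat) (e p : bool) : x < n ->
  exists mb : nat * bool,
    [/\ mb.1 <= (if e then n else 2 * n - 2 + p), odd mb.1 = p &
      (if mb.2 then s ^+ e * r ^+ mb.1 else r ^+ mb.1 * s ^+ e)
        = r ^+ x * s ^+ e].
Proof.
move=> ltx; case: e; last first.
  have [m [lem om rm]] := frame_parity p ltx.
  by exists (m, false); rewrite /= rm.
have [xp|xp] := eqVneq (odd x) p.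
  by exists (x, false); split=> //=; apply: ltnW.
exists (n - x, true); split=> /=; first exact: leq_subr.
  by rewrite oddB ?(ltnW ltx) // n_odd; move: xp; case: (odd x) p => [] [].
by rewrite !expg1 frame_reflection // ltnW.
Qed.

End DihedralFrame.

(** * Generators supported on single components *)

Definition split_gens (gT : finGroupType) (k : nat) (r s : gT) :
    {set {dffun forall _ : 'I_k, gT}} :=
  [set [ffun j => if j == i then r else 1] | i : 'I_k]
    :|: [set [ffun j => if j == i then s else 1] | i : 'I_k].

Lemma card_split_gens (gT : finGroupType) (k : nat) (r s : gT) :
  #|split_gens k r s| <= k * 2.
Proof.
rewrite (leq_trans (leq_card_setU _ _)) // muln2 -addnn.
have leim (F : 'I_k -> {dffun forall _ : 'I_k, gT}) : #|[set F i | i : 'I_k]| <= k.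
  by rewrite -[leqRHS]card_ord leq_imset_card.
by rewrite leq_add.
Qed.

Lemma split_gens_word (gT : finGroupType) (n k : nat) (r s : gT) :
    dihedral_frame n r s ->
  forall g, exists2 l, l <= k * n & has_word (split_gens k r s) g l.
Proof.
move=> [_ _ _ rs]; apply: has_word_power => i y.
have [x [e [ltx ->]]] := rs y; exists (x + e); first by case: e; lia.
have memA z : z \in [:: r; s] ->
    [ffun j => if j == i then z else 1] \in split_gens k r s.
  by rewrite !inE => /orP[] /eqP->; rewrite imset_f ?orbT.
have -> : [ffun j : 'I_k => if j == i then r ^+ x * s ^+ e else 1]
    = [ffun j : 'I_k => if j == i then r else 1] ^+ x
      * [ffun j : 'I_k => if j == i then s else 1] ^+ e.
  apply/ffunP=> j; rewrite !(ffunE, dffunX).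
  by case: eqP; rewrite // !expg1n mulg1.
by apply: has_wordM; apply: has_wordX; apply: memA; rewrite !inE eqxx ?orbT.
Qed.

(** * Cyclic generators, each linking two neighbouring components *)

Definition cyclic_gen (gT : finGroupType) (k : nat) (r s : gT) (i : 'I_k.+2) :
    {dffun forall _ : 'I_k.+2, gT} :=
  [ffun l => if l == i then s else if l == (i + 1)%R then r else 1].

Definition cyclic_gens (gT : finGroupType) (k : nat) (r s : gT) :
    {set {dffun forall _ : 'I_k.+2, gT}} :=
  [set cyclic_gen r s i | i : 'I_k.+2].

Lemma cyclic_genX (gT : finGroupType) (k : nat) (r s : gT) (i l : 'I_k.+2) m :
  (cyclic_gen r s i ^+ m) l =
    if l == i then s ^+ m else if l == (i + 1)%R then r ^+ m else 1.
Proof.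
by rewrite dffunX ffunE; case: ifP => // _; case: ifP => // _; rewrite expg1n.
Qed.

(** Indices are integers modulo k + 2. For t < k + 2 no reduction occurs, so offsets from [j] can be
    compared as natural numbers. *)
Lemma eq_shift_ord (k : nat) (i j : 'I_k.+2) (t : nat) : t < k.+2 ->
  (i == (j + inZp t)%R) = ((i - j)%R == t :> nat).
Proof.
move=> ltt; rewrite GRing.addrC -GRing.subr_eq -val_eqE /=.
by rewrite [X in _ == X]modn_small.
Qed.

(* Component [i] of the product of the blocks [cyclic_gen r s l ^+ m l] for
   [l = j, j + 1, ..., j + t], taken in turn and put in front of ([f l]) or
   behind the product of the previous ones. *)
Definition cyclic_partial (gT : finGroupType) (k : nat) (r s : gT)
    (j : 'I_k.+2) (m : 'I_k.+2 -> nat) (f : 'I_k.+2 -> bool) (t : nat) :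
    {dffun forall _ : 'I_k.+2, gT} :=
  [ffun i =>
    if (i - j)%R == 0 :> nat then s ^+ m j
    else if ((i - j)%R <= t)%N then
      if f i then s ^+ m i * r ^+ m (i - 1)%R else r ^+ m (i - 1)%R * s ^+ m i
    else if (i - j)%R == t.+1 :> nat then r ^+ m (i - 1)%R else 1].

(** A new block at c completes component c, on the side given by [f c], and opens component c + 1.
    The range of t stops before component [j] is met again. *)
Lemma cyclic_partial_word (gT : finGroupType) (k : nat) (r s : gT)
    (j : 'I_k.+2) (m : 'I_k.+2 -> nat) (f : 'I_k.+2 -> bool) (t : nat) :
    t < k.+1 ->
  has_word (cyclic_gens k r s) (cyclic_partial r s j m f t)
    (\sum_(u < t.+1) m (j + inZp u)%R).
Proof.
have memA i : cyclic_gen r s i \in cyclic_gens k r s by rewrite imset_f.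
elim: t => [|t IHt] ltt.
  have -> : cyclic_partial r s j m f 0 = cyclic_gen r s j ^+ m j.
    apply/ffunP=> i; rewrite cyclic_genX ffunE leqn0.
    have := @eq_shift_ord k i j 0 isT; have := @eq_shift_ord k i j 1 isT.
    have -> : inZp 0 = 0%R :> 'I_k.+2 by apply/val_inj.
    have -> : inZp 1 = 1%R :> 'I_k.+2 by apply/val_inj.
    rewrite GRing.addr0 => <- <-.
    case: eqVneq => // _; case: eqVneq => // ->.
    by rewrite GRing.addrK.
  rewrite big_ord1 /= (_ : inZp 0 = 0%R) ?GRing.addr0; last exact/val_inj.
  exact: has_wordX.
have wt := IHt (ltnW ltt); pose c : 'I_k.+2 := (j + inZp t.+1)%R.
have wc := has_wordX (m c) (memA c).
have eqc i : (i == c) = ((i - j)%R == t.+1 :> nat).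
  by apply: eq_shift_ord; apply: ltnW.
have eqc1 i : (i == (c + 1)%R) = ((i - j)%R == t.+2 :> nat).
  rewrite -(@eq_shift_ord _ i j t.+2) // /c -GRing.addrA; congr (_ == (_ + _)%R).
  by apply/val_inj; rewrite /= modnDm addn1.
have -> : cyclic_partial r s j m f t.+1 =
    if f c then cyclic_gen r s c ^+ m c * cyclic_partial r s j m f t
    else cyclic_partial r s j m f t * cyclic_gen r s c ^+ m c.
  transitivity [ffun i => if f c
      then (cyclic_gen r s c ^+ m c) i * cyclic_partial r s j m f t i
      else cyclic_partial r s j m f t i * (cyclic_gen r s c ^+ m c) i];
    last by apply/ffunP=> i; case: (f c); rewrite !ffunE.
  apply/ffunP=> i; rewrite !ffunE !cyclic_genX eqc eqc1.
  have [dt|dt] := eqVneq ((i - j)%R : nat) t.+1.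
    have ic : i = c by apply/eqP; rewrite eqc dt.
    by rewrite dt leqnn ltnn /= ic; case: (f c).
  have [dt2|dt2] := eqVneq ((i - j)%R : nat) t.+2.
    have ic : (i - 1)%R = c by apply/eqP; rewrite GRing.subr_eq eqc1 dt2.
    rewrite dt2 /= ltnn ltnNge leqnSn /= ic mulg1 mul1g.
    by case: (f c).
  rewrite mulg1 mul1g if_same; case: eqP => // _.
  by rewrite [in LHS]leq_eqVlt (negPf dt).
rewrite big_ord_recr /=; case: (f c); last exact: has_wordM.
by rewrite addnC; apply: has_wordM.
Qed.

(** The last block, at j - 1, closes the cycle: its side is chosen for component j - 1, and this
    forces the order of the factors in component [j]. *)
Lemma cyclic_gens_word (gT : finGroupType) (k : nat) (r s : gT)
    (j : 'I_k.+2) (m : 'I_k.+2 -> nat) (f : 'I_k.+2 -> bool)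
    (g : {dffun forall _ : 'I_k.+2, gT}) :
    (forall i, i != j -> g i =
       if f i then s ^+ m i * r ^+ m (i - 1)%R else r ^+ m (i - 1)%R * s ^+ m i) ->
    g j = (if f (j - 1)%R then r ^+ m (j - 1)%R * s ^+ m j
           else s ^+ m j * r ^+ m (j - 1)%R) ->
  has_word (cyclic_gens k r s) g (\sum_i m i).
Proof.
move=> gi gj; pose c := (j - 1)%R; have cj : (c + 1)%R = j by rewrite GRing.subrK.
have def_c : c = (j + inZp k.+1)%R.
  rewrite -[LHS](GRing.subrK j) GRing.addrC; congr (_ + _)%R.
  rewrite /c GRing.addrAC GRing.subrr GRing.add0r; apply/val_inj => /=.
  by rewrite [1 %% _]modn_small // subn1.
have eqc i : (i == c) = ((i - j)%R == k.+1 :> nat).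
  by rewrite def_c; apply: eq_shift_ord.
have eqj i : (i == j) = ((i - j)%R == 0 :> nat).
  by rewrite -GRing.subr_eq0 -val_eqE.
have neq_jc : j != c by rewrite eqc GRing.subrr.
have wt := cyclic_partial_word r s j m f (ltnSn k).
have wc : has_word (cyclic_gens k r s) (cyclic_gen r s c ^+ m c) (m c).
  by apply: has_wordX; rewrite imset_f.
have -> : \sum_i m i = (\sum_(u < k.+1) m (j + inZp u)%R + m c)%N.
  rewrite (reindex_inj (GRing.addrI j)) /=.
  rewrite (eq_bigr (fun u : 'I_k.+2 => m (j + inZp u)%R)) => [|u _]; last first.
    by rewrite valZpK.
  by rewrite big_ord_recr /= -def_c.
have -> : g = if f c then cyclic_gen r s c ^+ m c * cyclic_partial r s j m f k
    else cyclic_partial r s j m f k * cyclic_gen r s c ^+ m c.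
  transitivity [ffun i => if f c
      then (cyclic_gen r s c ^+ m c) i * cyclic_partial r s j m f k i
      else cyclic_partial r s j m f k i * (cyclic_gen r s c ^+ m c) i];
    last by apply/ffunP=> i; case: (f c); rewrite !ffunE.
  apply/ffunP=> i; rewrite !ffunE !cyclic_genX cj -eqj.
  have [->|ij] := eqVneq i j; first by rewrite (negPf neq_jc).
  rewrite gi //; have [ic|ic] := eqVneq i c.
    have /eqP -> : (i - j)%R == k.+1 :> nat by rewrite -eqc ic.
    by rewrite ltnn eqxx /= -ic.
  have -> : ((i - j)%R <= k)%N.
    by rewrite -ltnS ltn_neqAle -eqc ic -ltnS ltn_ord.
  by rewrite mulg1 mul1g if_same.
case: (f c); last exact: has_wordM.
by rewrite addnC; apply: has_wordM.
Qed.

Lemma cyclic_gens_diam (gT : finGroupType) (n k : nat) (r s : gT) :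
    dihedral_frame n r s -> odd n -> 3 <= n ->
  forall g, exists2 l, l <= k.+2 * (2 * n - 2)
    & has_word (cyclic_gens k r s) g l.
Proof.
move=> rs_frame n_odd n_ge3 g.
have [_ _ _ rs] := rs_frame.
have [x /fin_all_exists[e xe]] := fin_all_exists (fun i => rs (g i)).
have short i := frame_parity_short rs_frame n_odd (e (i + 1)%R) (e i)
  (xe (i + 1)%R).1.
have [mb mbP] := fin_all_exists short.
(* The cyclic order is cut at a component without reflection, if any. *)
have [j jP] : exists j, e j -> forall i, e i.
  have [/forallP eT|] := boolP [forall i, e i]; first by exists ord0.
  by rewrite negb_forall => /existsP[j /negPf ej]; exists j; rewrite ej.
(* [mb i] fixes the exponent of block i through component i + 1, hence the shift. *)
pose f i := (mb (i - 1)%R).2.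
have [m0 [le_m0 om0 m0P]] := frame_parity_side rs_frame n_odd (f (j - 1)%R)
  (e j) (e (j - 1)%R) (xe j).1.
(* Only block j - 1 is changed, to suit the forced order in component [j]. Its parity is kept, so
   its power of [s] in component j - 1 is unaffected. *)
pose m i := if i == (j - 1)%R then m0 else (mb i).1.
have om i : odd (m i) = e i.
  by rewrite /m; case: eqP => [->//|_]; have [_ ->] := mbP i.
have sm i : s ^+ m i = s ^+ e i by rewrite (frame_sX rs_frame) om.
exists (\sum_i m i); last first.
  apply: (cyclic_gens_word (f := f) (j := j)) => [i ij|].
    have [_ _] := mbP (i - 1)%R; rewrite GRing.subrK => mbi.
    by rewrite sm (xe i).2 -mbi /m (inj_eq (@GRing.addIr _ _)) (negPf ij).
  by rewrite sm (xe j).2 -m0P /m eqxx.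
case ej: (e j); last first.
  have le_m i : m i + e (i + 1)%R <= 2 * n - 2 + e i.
    rewrite /m; case: eqP => [->|_].
      by rewrite GRing.subrK ej addn0.
    (* If component i + 1 has a reflection, this is n + 1 <= 2n - 2, which uses n >= 3. *)
    by have [+ _ _] := mbP i; case: (e (i + 1)%R); lia.
  have eS : (\sum_i e (i + 1)%R = \sum_i e i :> nat)%N.
    by rewrite [RHS](reindex_inj (GRing.addIr 1%R)).
  have : \sum_i (m i + e (i + 1)%R) <= \sum_i (2 * n - 2 + e i) by apply: leq_sum.
  by rewrite !big_split /= eS leq_add2r sum_nat_const card_ord.
have eT := jP ej.
rewrite (bigD1 (j - 1)%R) //= {1}/m eqxx.
have : \sum_(i | i != (j - 1)%R) m i <= k.+1 * n.
  apply: (@leq_trans (\sum_(i | i != (j - 1)%R) n)).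
    by apply: leq_sum => i ij; rewrite /m (negPf ij); have [] := mbP i; rewrite eT.
  by rewrite sum_nat_const cardC1 card_ord.
(* It remains that (2n - 1) + (k + 1)n <= (k + 2)(2n - 2), that is, 0 <= (n - 3) + k(n - 2). *)
have : k * 3 <= k * n by rewrite leq_mul2l n_ge3 orbT.
by move: le_m0; rewrite eT /= mulnBr; lia.
Qed.

Lemma card_cyclic_gens (gT : finGroupType) (k : nat) (r s : gT) :
  #|cyclic_gens k r s| <= k.+2.
Proof. by rewrite -[leqRHS]card_ord leq_imset_card. Qed.

(** * Ranks of dihedral groups and their powers *)

Lemma gen_rank_dihedral_power_ge (n k : nat) : 1 < n ->
  k * (~~ odd n).+1 <= 'm([set: dihedral_power n k]).
Proof.
move=> n_gt1; have [r [s rs_frame]] := dihedral_frame_exists n_gt1.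
have [or _ _ _] := rs_frame.
apply: gen_rank_power_ge (frame_square rs_frame) _.
(* Since r^2 has order n / gcd(n, 2), its subgroup has index 2 for odd n and 4 for even n. *)
have card_r2 : (#[r ^+ 2] * 2 ^ ~~ odd n)%N = n.
  have -> : (2 ^ ~~ odd n)%N = gcdn n 2.
    case: (boolP (odd n)) => [n_odd|n_even].
      by apply/esym/eqP; rewrite -/(coprime n 2) coprimen2.
    by apply/esym/gcdn_idPr; rewrite dvdn2.
  by rewrite orderXgcd or divnK // dvdn_gcdl.
have card_D : #|[set: dihedral n]| = n.*2 by apply: card_dihedral.
have /eqP : (#[r ^+ 2] * #|[set: dihedral n] : <[r ^+ 2]>|
    = #[r ^+ 2] * 2 ^ (~~ odd n).+1)%N.
  by rewrite (Lagrange (subsetT _)) card_D expnS mulnCA card_r2 mul2n.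
rewrite eqn_pmul2l ?order_gt0 // => /eqP->.
exact: dvdnn.
Qed.

(** The rank is subtracted in the target, so this upper bound yields 2n - 2 <= |D_n| - rank(D_n). *)
Lemma gen_rank_dihedral_le2 (n : nat) : 1 < n -> 'm([set: dihedral n]) <= 2.
Proof.
move=> n_gt1; have [r [s [_ _ _ rs]]] := dihedral_frame_exists n_gt1.
have <- : <<[set r; s]>> = [set: dihedral n].
  apply/setP=> y; rewrite inE; have [x [e [_ ->]]] := rs y.
  by rewrite groupM // groupX // mem_gen // !inE eqxx ?orbT.
by rewrite (leq_trans (grank_min _)) // cards2 ltnS leq_b1.
Qed.

(** A group of rank at most 1 is abelian; then r = r^-1, against n > 2. This covers odd n, where the
    quotient by squares only gives 1. *)
Lemma gen_rank_dihedral_power1_ge2 (n : nat) : 2 < n ->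
  2 <= 'm([set: dihedral_power n 1]).
Proof.
move=> n_gt2; have [r [s [or s2 rs _]]] := dihedral_frame_exists (ltnW n_gt2).
rewrite ltnNge; apply/negP=> rank_le1.
have [B defB cardB] := grank_witness [group of [set: dihedral_power n 1]].
have abB : abelian [set: dihedral_power n 1].
  rewrite -defB abelian_gen; move: rank_le1; rewrite -cardB => /card_le1P B1.
  apply/centsP=> y By z Bz.
  by move: (B1 y By z); rewrite Bz inE => /esym/eqP->.
have /ffunP/(_ ord0) := centsP abB [ffun=> r] (in_setT _) [ffun=> s] (in_setT _).
rewrite !ffunE => /commgP/conjg_fixP; rewrite rs => r_inv.
have : #[r] %| 2 by rewrite order_dvdn (expgS _ 1) expg1 -{1}r_inv mulVg.
by rewrite or => /(dvdn_leq (isT : 0 < 2)); rewrite leqNgt n_gt2.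
Qed.

Theorem corollary5p10 (n k : nat) (hn : (3 <= n)%N) (hk : (1 <= k)%N)
    (hnk : ~~ odd n \/ (2 * k <= 3 * (n - 1))%N) :
  exists A : {set dihedral_power n k},
    [/\ <<A>>%g = [set: dihedral_power n k],
        #|A| = 'm([set: dihedral_power n k])%g
      & (diam [set: dihedral_power n k] A
           <= k * (#|[set: dihedral n]| - 'm([set: dihedral n])%g))%N].
Proof.
have n_gt1 : 1 < n by apply: ltnW.
have [r [s rs_frame]] := dihedral_frame_exists n_gt1.
(* [c] is sandwiched: a generating set has at least as many elements as the rank, so |A| equals
   it. *)
suff [A [c [le_card le_rank wA]]] : exists (A : {set dihedral_power n k}) (c : nat),
    [/\ #|A| <= c, c <= 'm([set: dihedral_power n k]) &
      forall g, exists2 l, l <= k * (2 * n - 2) & has_word A g l].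
  have [defA diamA] := gen_diam_bound wA; exists A; split=> //.
    apply/eqP; rewrite eqn_leq (leq_trans le_card le_rank) -defA.
    exact: grank_min.
  apply: leq_trans diamA _; rewrite leq_mul2l card_dihedral // -mul2n.
  by rewrite leq_sub2l ?orbT // gen_rank_dihedral_le2.
case: (boolP (odd n && (1 < k))) => [/andP[n_odd]|].
  case: k hk hnk => [|[|k]] // _ _ _; exists (cyclic_gens k r s), k.+2; split.
  - exact: card_cyclic_gens.
  - by have := gen_rank_dihedral_power_ge k.+2 n_gt1; rewrite n_odd muln1.
  exact: (cyclic_gens_diam rs_frame).
move=> n_even_or_k1; exists (split_gens k r s), (k * 2)%N; split.
- exact: card_split_gens.
- move: n_even_or_k1; rewrite negb_and -leqNgt.
  case/orP=> [n_even|k_le1].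
    by have := gen_rank_dihedral_power_ge k n_gt1; rewrite n_even.
  have k1 : k = 1%N by apply/eqP; rewrite eqn_leq k_le1.
  subst k; exact: gen_rank_dihedral_power1_ge2.
move=> g; have [l lel wl] := split_gens_word rs_frame g.
by exists l => //; apply: leq_trans lel _; rewrite leq_mul2l; lia.
Qed.
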